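(* Let $T\in\mathcal{L}(\mathcal{H})$ be a contraction of class $C_0(N)$, let $\mathcal{U}$ be the set of unitary $N$-dilations of $T$ to $\mathcal{H}\oplus\mathbb{C}^N$ (unitary operators $\mathbf{U}$ on $\mathcal{H}\oplus\mathbb{C}^N$ with $P_{\mathcal{H}}\mathbf{U}|_{\mathcal{H}}=T$), and define $\tau:\mathcal{U}\to\mathfrak{K}$ by $\tau(\mathbf{U})=\overline{W(\mathbf{U})}$. Then $\tau$ wraps $\overline{W(T)}$. In particular, $\overline{W(T)}=\bigcap_{\mathbf{U}\in\mathcal{U}}\overline{W(\mathbf{U})}$.
   Context: A contraction $T$ on a separable Hilbert space $\mathcal{H}$ is of class $C_0(N)$ if $\dim\mathcal{D}_T=\dim\mathcal{D}_{T^*}=N<\infty$ (where $\mathcal{D}_T=\overline{\operatorname{ran}(I-T^*T)^{1/2}}$, $\mathcal{D}_{T^*}=\overline{\operatorname{ran}(I-TT^* )^{1/2}}$) and both $T^n$ and $T^{*n}$ tend strongly to $0$. $W$ denotes numerical range. $\mathfrak{K}$ is the space of nonempty compact subsets of $\mathbb{C}$ with the Hausdorff distance; $\mathcal{U}$ carries the operator norm topology (it is compact). A continuous $\tau$ wraps $A\in\mathfrak{K}$ if for every open half-plane $\mathbb{H}$ containing $A$ there exists $\mathbf{U}\in\mathcal{U}$ with $\tau(\mathbf{U})\subset\mathbb{H}$. *)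

(* Defs.v *)
From HB Require Import structures.
From mathcomp Require Import all_boot all_order all_algebra.
From mathcomp Require Import all_classical all_reals.
From mathcomp Require Import complex.
Set Implicit Arguments.
Unset Strict Implicit.
Unset Printing Implicit Defensive.
Import Order.TTheory GRing.Theory Num.Theory.
Local Open Scope ring_scope.
Local Open Scope classical_set_scope.

Section HilbertDefs.
Variable R : realType.
Local Notation C := R[i].

Definition cabs (z : C) : R := Normc.normc z.

Variable V : lmodType C.
Variable ip : V -> V -> C.

Definition hnorm (x : V) : R := Num.sqrt (complex.Re (ip x x)).

Definition is_inner_product : Prop :=
  [/\ (forall (a : C) (x y z : V), ip (a *: x + y) z = a * ip x z + ip y z),
      (forall x y : V, ip x y = conjc (ip y x)),
      (forall x : V, complex.Im (ip x x) = 0 /\ 0 <= complex.Re (ip x x))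
    & (forall x : V, ip x x = 0 -> x = 0)].

Definition cvg_to (u : nat -> V) (l : V) : Prop :=
  forall e : R, 0 < e -> exists n0 : nat, forall n, (n0 <= n)%N -> hnorm (u n - l) < e.

Definition cauchy_seq (u : nat -> V) : Prop :=
  forall e : R, 0 < e -> exists n0 : nat, forall m n, (n0 <= m)%N -> (n0 <= n)%N ->
    hnorm (u m - u n) < e.

Definition complete_ip : Prop := forall u, cauchy_seq u -> exists l, cvg_to u l.

Definition separable_ip : Prop :=
  exists d : nat -> V, forall (x : V) (e : R), 0 < e -> exists n, hnorm (x - d n) < e.

Definition is_hilbert : Prop := [/\ is_inner_product, complete_ip & separable_ip].

Definition bounded_op (T : V -> V) : Prop :=
  (forall (a : C) (x y : V), T (a *: x + y) = a *: T x + T y) /\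
  exists M : R, forall x, hnorm (T x) <= M * hnorm x.

Definition is_adjoint (T S : V -> V) : Prop := forall x y, ip (T x) y = ip x (S y).

Definition contraction (T : V -> V) : Prop := forall x, hnorm (T x) <= hnorm x.

Definition strongly_to0 (f : nat -> V -> V) : Prop := forall x, cvg_to (fun n => f n x) 0.

Definition positive_op (S : V -> V) : Prop :=
  [/\ bounded_op S, is_adjoint S S &
      forall x, complex.Im (ip (S x) x) = 0 /\ 0 <= complex.Re (ip (S x) x)].

Definition is_pos_sqrt (S A : V -> V) : Prop := positive_op S /\ forall x, S (S x) = A x.

Definition in_closure_range (S : V -> V) (y : V) : Prop :=
  forall e : R, 0 < e -> exists x, hnorm (y - S x) < e.

Definition closure_range_dim (S : V -> V) (N : nat) : Prop :=
  exists e : 'I_N -> V,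
    [/\ (forall i j, ip (e i) (e j) = (i == j)%:R),
        (forall i, in_closure_range S (e i)) &
        (forall y, in_closure_range S y -> y = \sum_i ip y (e i) *: e i)].

Definition defect_dim (T Tadj : V -> V) (N : nat) : Prop :=
  exists D, is_pos_sqrt D (fun x => x - Tadj (T x)) /\ closure_range_dim D N.

Definition class_C0N (T Tadj : V -> V) (N : nat) : Prop :=
  [/\ contraction T, defect_dim T Tadj N, defect_dim Tadj T N,
      strongly_to0 (fun n => iter n T) & strongly_to0 (fun n => iter n Tadj)].

Definition numrange (T : V -> V) : set C :=
  [set ip (T x) x | x in [set x | hnorm x = 1]].

Definition opnorm (X : V -> V) : R := sup [set hnorm (X x) | x in [set x | hnorm x <= 1]].

Definition unitary (U : V -> V) : Prop :=
  bounded_op U /\ exists Us, [/\ is_adjoint U Us, cancel U Us & cancel Us U].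

End HilbertDefs.

Section PlaneDefs.
Variable R : realType.
Local Notation C := R[i].

Definition clC (A : set C) : set C :=
  [set z | forall e : R, 0 < e -> exists2 w, A w & cabs (z - w) < e].

Definition hausdorff (A B : set C) : R :=
  Num.max (sup [set inf [set cabs (a - b) | b in B] | a in A])
          (sup [set inf [set cabs (a - b) | a in A] | b in B]).

(* open half-plane {z | complex.Re (conj w * z) < c}, w <> 0 (every open half-plane has this form) *)
Definition halfplane (w : C) (c : R) : set C := [set z | complex.Re (conjc w * z) < c].

Definition wraps (X : Type) (D : set X) (d : X -> X -> R) (tau : X -> set C) (A : set C) : Prop :=
  (forall x, D x -> forall e : R, 0 < e -> exists2 del : R, 0 < del &
     forall y, D y -> d x y < del -> hausdorff (tau x) (tau y) < e) /\
  (forall (w : C) (c : R), w != 0 -> A `<=` halfplane w c ->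
     exists2 x, D x & tau x `<=` halfplane w c).

End PlaneDefs.

Section Dilation.
Variable R : realType.
Local Notation C := R[i].
Variable V : lmodType C.
Variable ip : V -> V -> C.

Definition ipsum (N : nat) (p q : (V * 'cV[C]_N)%type) : C :=
  ip p.1 q.1 + \sum_(i < N) p.2 i 0 * conjc (q.2 i 0).

Definition unitary_dilation (N : nat) (T : V -> V) (U : (V * 'cV[C]_N)%type -> (V * 'cV[C]_N)%type)
  : Prop := unitary (@ipsum N) U /\ forall x : V, (U (x, 0)).1 = T x.

End Dilation.
Arguments ipsum {R V} ip N p q.
Arguments unitary_dilation {R V} ip N T U.

(* Main.v *)
Require Import Defs.
From HB Require Import structures.
From mathcomp Require Import all_boot all_order all_algebra.
From mathcomp Require Import all_classical all_reals.
From mathcomp Require Import complex.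
From mathcomp Require Import ring lra.
Import Order.TTheory GRing.Theory Num.Theory.
Local Open Scope ring_scope.
Local Open Scope classical_set_scope.

(* Suppose [Re (w^* z) <= c1] on W(T), and let [c1 < c <= |w|].  Choose [mu] on the unit circle
   with [Re (w^* mu) = c]; then [mu - T] is invertible by the Lax-Milgram lemma, and this lets one
   build a unitary N-dilation U having [mu] as an eigenvalue, with an N-dimensional eigenspace E
   complementary to H in H + C^N.  The Hermitian form [c |p|^2 - Re (w^* <U p, p>)] has E in its
   kernel, so its positivity on H, where U compresses to T, gives [Re (w^* z) <= c] on W(U).
   For half-planes [Re (w^* z) < c] with [c > |w|] any unitary N-dilation will do.
   The intersection formula then follows from the convexity of W(T). *)

(** * Complex numbers and inner products *)

(** The bound on [W(T)] enters as coercivity: [Re <conj w (mu - T) x, x> >= (c - c1) |x|^2]. This is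
    why a strict gap [c1 < c] has to be extracted from the closure of [W(T)], and why [c <= |w|] is
    imposed: the line [Re (conj w z) = c] must meet the unit circle. The adjoint [S] of [T]
    satisfies the same bound with [conj w] and [mu] replaced by their conjugates. The eigenspace is
    dictated by isometry. Let [J x = (T x, C x)] with [C^* C = 1 - S T]. If [U] extends [J] and
    [U (v, xi) = mu (v, xi)], preservation of the inner products with [J x] forces
    [(conj mu - S) v = C^* xi]; inverting [conj mu - S] turns the eigenspace into a graph over
    [C^N]. In infinite dimension the isometry so obtained still has to be shown onto, and there the
    invertibility of [mu - T] itself is used. *)

Section ComplexModulus.
Context {R : realType}.
Implicit Types z w : R[i].

Lemma ReD z w : complex.Re (z + w) = complex.Re z + complex.Re w.
Proof. by case: z w => [? ?] [? ?]. Qed.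

Lemma ReN z : complex.Re (- z) = - complex.Re z.
Proof. by case: z. Qed.

Lemma ReB z w : complex.Re (z - w) = complex.Re z - complex.Re w.
Proof. by rewrite ReD ReN. Qed.

Lemma Re_conjc z : complex.Re (conjc z) = complex.Re z.
Proof. by case: z. Qed.

Lemma ReM_real (a : R) z : complex.Re (a%:C%C * z) = a * complex.Re z.
Proof. by case: z => x y /=; ring. Qed.

Lemma mul_conjc z : z * conjc z = ((cabs z) ^+ 2)%:C%C.
Proof.
case: z => a b; rewrite /cabs /= sqr_sqrtr ?addr_ge0 ?sqr_ge0 //.
by apply/eqP; rewrite eq_complex /=; apply/andP; split; apply/eqP; ring.
Qed.

Lemma cabs_sqr z : cabs z ^+ 2 = complex.Re z ^+ 2 + complex.Im z ^+ 2.
Proof. by case: z => a b; rewrite /cabs /= sqr_sqrtr ?addr_ge0 ?sqr_ge0. Qed.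

Lemma cabs_ge0 z : 0 <= cabs z.
Proof. by case: z => a b; apply: sqrtr_ge0. Qed.

Lemma cabsM z w : cabs (z * w) = cabs z * cabs w.
Proof. exact: Normc.normcM. Qed.

Lemma cabsN z : cabs (- z) = cabs z.
Proof. exact: normcN. Qed.

Lemma cabsC z w : cabs (z - w) = cabs (w - z).
Proof. by rewrite -cabsN opprB. Qed.

Lemma cabs_conjc z : cabs (conjc z) = cabs z.
Proof. by case: z => a b; rewrite /cabs /= sqrrN. Qed.

Lemma le_cabsD z w : cabs (z + w) <= cabs z + cabs w.
Proof. exact: le_normcD. Qed.

Lemma cabs_eq0 z : cabs z = 0 -> z = 0.
Proof. exact: Normc.eq0_normc. Qed.

Lemma cabs_gt0 z : z != 0 -> 0 < cabs z.
Proof.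
by move=> z0; rewrite lt0r cabs_ge0 andbT; apply: contra_neq z0; apply: cabs_eq0.
Qed.

Lemma normr_Re_le z : `|complex.Re z| <= cabs z.
Proof.
case: z => a b; rewrite /cabs /= -sqrtr_sqr.
by apply: ler_wsqrtr; rewrite lerDl sqr_ge0.
Qed.

Lemma Re_le_cabs z : complex.Re z <= cabs z.
Proof. exact: le_trans (ler_norm _) (normr_Re_le z). Qed.

Lemma normr_Im_le z : `|complex.Im z| <= cabs z.
Proof.
case: z => a b; rewrite /cabs /= -sqrtr_sqr.
by apply: ler_wsqrtr; rewrite lerDr sqr_ge0.
Qed.

Lemma cabs_le_ReIm z : cabs z <= `|complex.Re z| + `|complex.Im z|.
Proof.
case: z => a b; rewrite /cabs /=.
rewrite -[leRHS]ger0_norm ?addr_ge0 // -sqrtr_sqr; apply: ler_wsqrtr.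
rewrite sqrrD !real_normK ?num_real // -addrA lerD2l lerDr mulrn_wge0 //.
by rewrite mulr_ge0.
Qed.

Lemma exists_unimodular_Re w (c : R) : w != 0 -> `|c| <= cabs w ->
  exists mu : R[i], [/\ cabs mu = 1, mu * conjc mu = 1 & complex.Re (conjc w * mu) = c].
Proof.
move=> w0 cw; have W0 := cabs_gt0 w w0.
have c2 : c ^+ 2 <= cabs w ^+ 2.
  by rewrite -[c ^+ 2]real_normK ?num_real // ler_sqr ?nnegrE ?cabs_ge0.
set r := cabs w; have r0 : r != 0 by rewrite gt_eqF.
set s := Num.sqrt (r ^+ 2 - c ^+ 2).
have s2 : s ^+ 2 = r ^+ 2 - c ^+ 2 by rewrite sqr_sqrtr // subr_ge0.
(* Solves [conj w * mu = c + i s], where [s] gives the right-hand side modulus [|w|]. *)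
pose mu : R[i] := w * ((c +i* s)%C * ((r ^+ 2)^-1)%:C%C).
have abs_cs : cabs (c +i* s)%C = r.
  by rewrite /cabs /= s2 addrC subrK sqrtr_sqr ger0_norm // ltW.
have abs_r : cabs (((r ^+ 2)^-1)%:C%C : R[i]) = (r ^+ 2)^-1.
  rewrite /cabs /= expr0n addr0 sqrtr_sqr ger0_norm //.
  by rewrite invr_ge0 sqr_ge0.
have mu1 : cabs mu = 1 by rewrite /mu !cabsM abs_cs abs_r -/r; field.
exists mu; split=> //; first by rewrite mul_conjc mu1 expr1n.
rewrite /mu mulrA [conjc w * w]mulrC mul_conjc -/r ReM_real /=.
by field.
Qed.

End ComplexModulus.

Section InnerProduct.
Context {R : realType} {V : lmodType R[i]} {ip : V -> V -> R[i]}.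
Hypothesis ipP : is_inner_product ip.
Implicit Types (x y z : V) (a : R[i]).
Local Notation hn := (hnorm ip).

Lemma ip_conj x y : ip x y = conjc (ip y x).
Proof. by case: ipP. Qed.

Lemma ipDl x y z : ip (x + y) z = ip x z + ip y z.
Proof. by case: ipP => H _ _ _; rewrite -[x]scale1r H mul1r scale1r. Qed.

Lemma ip0l z : ip 0 z = 0.
Proof. by apply: (addrI (ip 0 z)); rewrite -ipDl !addr0. Qed.

Lemma ipZl a x z : ip (a *: x) z = a * ip x z.
Proof. by case: ipP => H _ _ _; rewrite -[a *: x]addr0 H ip0l addr0. Qed.

Lemma ipNl x z : ip (- x) z = - ip x z.
Proof. by rewrite -scaleN1r ipZl mulN1r. Qed.

Lemma ipBl x y z : ip (x - y) z = ip x z - ip y z.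
Proof. by rewrite ipDl ipNl. Qed.

Lemma ipDr x y z : ip z (x + y) = ip z x + ip z y.
Proof. by rewrite ip_conj ipDl rmorphD /= -!ip_conj. Qed.

Lemma ip0r z : ip z 0 = 0.
Proof. by rewrite ip_conj ip0l rmorph0. Qed.

Lemma ipZr a x z : ip z (a *: x) = conjc a * ip z x.
Proof. by rewrite ip_conj ipZl rmorphM /= -ip_conj. Qed.

Lemma ipNr x z : ip z (- x) = - ip z x.
Proof. by rewrite ip_conj ipNl rmorphN /= -ip_conj. Qed.

Lemma ipBr x y z : ip z (x - y) = ip z x - ip z y.
Proof. by rewrite ipDr ipNr. Qed.

Lemma ip_suml (I : finType) (f : I -> V) z : ip (\sum_i f i) z = \sum_i ip (f i) z.
Proof. by elim/big_rec2: _ => [|i a x _ <-]; rewrite ?ip0l ?ipDl. Qed.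

Lemma ip_sumr (I : finType) (f : I -> V) z : ip z (\sum_i f i) = \sum_i ip z (f i).
Proof. by elim/big_rec2: _ => [|i a x _ <-]; rewrite ?ip0r ?ipDr. Qed.

Lemma ip_eq0 x : ip x x = 0 -> x = 0.
Proof. by case: ipP => _ _ _; apply. Qed.

Lemma ip_extl x y : (forall z, ip x z = ip y z) -> x = y.
Proof.
by move=> xy; apply/eqP; rewrite -subr_eq0; apply/eqP/ip_eq0; rewrite ipBl xy subrr.
Qed.

Lemma hnorm_ge0 x : 0 <= hn x.
Proof. exact: sqrtr_ge0. Qed.

Lemma hnorm_sqr x : hn x ^+ 2 = complex.Re (ip x x).
Proof. by rewrite sqr_sqrtr //; case: ipP => _ _ /(_ x) []. Qed.

Lemma ip_self x : ip x x = (hn x ^+ 2)%:C%C.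
Proof.
rewrite hnorm_sqr; case: ipP => _ _ /(_ x) [Im0 _] _.
by apply/eqP; rewrite eq_complex /= Im0 !eqxx.
Qed.

Lemma hnorm_eq0 x : hn x = 0 -> x = 0.
Proof. by move=> x0; apply: ip_eq0; rewrite ip_self x0 expr0n. Qed.

Lemma hnorm0 : hn 0 = 0.
Proof. by rewrite /hnorm ip0l sqrtr0. Qed.

Lemma hnormZ a x : hn (a *: x) = cabs a * hn x.
Proof.
apply: (@pexpIrn _ 2) => //; rewrite ?nnegrE ?hnorm_ge0 ?mulr_ge0 ?cabs_ge0 ?hnorm_ge0 //.
by apply: complexI; rewrite -ip_self ipZl ipZr mulrA mul_conjc ip_self -rmorphM -exprMn.
Qed.

Lemma hnormN x : hn (- x) = hn x.
Proof. by rewrite /hnorm ipNl ipNr opprK. Qed.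

Lemma hnorm_distC x y : hn (x - y) = hn (y - x).
Proof. by rewrite -hnormN opprB. Qed.

Lemma hnormD_sqr x y : hn (x + y) ^+ 2 = hn x ^+ 2 + complex.Re (ip x y) *+ 2 + hn y ^+ 2.
Proof.
rewrite !hnorm_sqr ipDl !ipDr !ReD (ip_conj y x) Re_conjc; ring.
Qed.

(** Expanding the square of the norm of [|y| x - |x| y] gives
    [2 |x| |y| (|x| |y| - Re <x, y>) >= 0]; vanishing norms are set aside so that the factor can be
    cancelled. *)
Lemma Re_ip_le x y : complex.Re (ip x y) <= hn x * hn y.
Proof.
have hx := hnorm_ge0 x; have hy := hnorm_ge0 y.
have [x0|xn0] := eqVneq (hn x) 0.
  by rewrite (hnorm_eq0 _ x0) ip0l hnorm0 mul0r.
have [y0|yn0] := eqVneq (hn y) 0.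
  by rewrite (hnorm_eq0 _ y0) ip0r hnorm0 mulr0.
have px : 0 < hn x by rewrite lt0r xn0.
have py : 0 < hn y by rewrite lt0r yn0.
have : 0 <= hn ((hn y)%:C%C *: x + - ((hn x)%:C%C *: y)) ^+ 2 by exact: sqr_ge0.
rewrite hnormD_sqr hnormN !hnormZ ipNr ipZl ipZr ReN conjc_real !ReM_real.
rewrite /cabs /= !expr0n !addr0 !sqrtr_sqr !ger0_norm //.
move=> H; have : 0 <= (hn x * hn y) * (hn x * hn y - complex.Re (ip x y)) by nra.
by rewrite pmulr_rge0 ?mulr_gt0 // subr_ge0.
Qed.

Lemma cabs_ip_le x y : cabs (ip x y) <= hn x * hn y.
Proof.
have [->|n0] := eqVneq (ip x y) 0; first by rewrite /cabs Normc.normc0 mulr_ge0 ?hnorm_ge0.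
(* Scaling [y] by [<x, y>] makes the pairing equal to the real number [|<x, y>|^2], and one factor
   [|<x, y>|] cancels. *)
have := Re_ip_le x (ip x y *: y).
rewrite ipZr mulrC mul_conjc hnormZ /= expr2 mulrCA.
by rewrite ler_pM2l // cabs_gt0.
Qed.

Lemma le_hnormD x y : hn (x + y) <= hn x + hn y.
Proof.
rewrite -ler_sqr ?nnegrE ?addr_ge0 ?hnorm_ge0 // hnormD_sqr sqrrD.
by rewrite lerD2r lerD2l lerMn2r Re_ip_le.
Qed.

Lemma le_hnormB x y : hn (x - y) <= hn x + hn y.
Proof. by rewrite -[hn y]hnormN le_hnormD. Qed.

Lemma hnorm_normalize x : x <> 0 -> hn (((hn x)^-1)%:C%C *: x) = 1.
Proof.
move=> x0; have n0 : hn x != 0 by apply/eqP => /hnorm_eq0.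
rewrite hnormZ /cabs /= expr0n addr0 sqrtr_sqr ger0_norm ?invr_ge0 ?hnorm_ge0 //.
exact: mulVf.
Qed.

End InnerProduct.

(** * The Lax-Milgram lemma *)

(** Bernoulli's inequality, in the division-free form [k^n (1 + n (1 - k)) <= 1], which also covers
    [k = 0]. *)
Lemma expr_eventually_lt {R : archiRealFieldType} (k e : R) : 0 <= k -> k < 1 -> 0 < e ->
  exists n0 : nat, forall n, (n0 <= n)%N -> k ^+ n < e.
Proof.
move=> k0 k1 e0; have d0 : 0 < 1 - k by rewrite subr_gt0.
have bernoulli n : k ^+ n * (1 + n%:R * (1 - k)) <= 1.
  elim: n => [|n IH]; first by rewrite expr0 mul0r addr0 mul1r.
  apply: le_trans IH; rewrite exprSr -mulrA ler_wpM2l ?exprn_ge0 //.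
  rewrite -natr1; have := mulr_ge0 (ler0n R n) (sqr_ge0 (1 - k)).
  by have := sqr_ge0 (1 - k); nra.
exists (Num.bound (e * (1 - k))^-1) => n len.
have ed0 : 0 < e * (1 - k) by rewrite mulr_gt0.
have n_large : (e * (1 - k))^-1 < n%:R.
  by apply: lt_le_trans (archi_boundP _) _; rewrite ?ler_nat // invr_ge0 ltW.
have {}n_large : 1 < n%:R * (e * (1 - k)) by rewrite -ltr_pdivrMr // div1r.
rewrite ltNge; apply/negP => ek.
have n0 : 0 <= 1 + n%:R * (1 - k) by rewrite addr_ge0 // mulr_ge0 // ltW.
have := le_trans (ler_wpM2r n0 ek) (bernoulli n).
by rewrite leNgt; apply/negP; rewrite negbK; nra.
Qed.

Section LaxMilgram.
Context {R : realType} {V : lmodType R[i]} {ip : V -> V -> R[i]}.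
Hypothesis ipP : is_inner_product ip.
Hypothesis ip_complete : complete_ip ip.
Local Notation hn := (hnorm ip).

Lemma contraction_fixpoint (g : V -> V) (k : R) : 0 <= k -> k < 1 ->
  (forall x y, hn (g x - g y) <= k * hn (x - y)) -> exists x, g x = x.
Proof.
move=> k0 k1 gk; pose u n := iter n g 0; pose C := hn (u 1%N - u 0%N).
have C0 : 0 <= C by exact: hnorm_ge0.
have d0 : 0 < 1 - k by rewrite subr_gt0.
have step n : hn (u n.+1 - u n) <= k ^+ n * C.
  elim: n => [|n IH]; first by rewrite expr0 mul1r.
  by rewrite exprS -mulrA; apply: le_trans (gk _ _) _; rewrite ler_wpM2l.
have tail n m : (1 - k) * hn (u (n + m)%N - u n) <= k ^+ n * C.
  (* Keeping the term [- k^(n + m)] of the geometric sum makes the induction on [m] close. *)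
  have tail' : (1 - k) * hn (u (n + m)%N - u n) <= (k ^+ n - k ^+ (n + m)) * C.
    elim: m => [|m IH]; first by rewrite addn0 !subrr hnorm0 // mulr0 mul0r.
    rewrite addnS -(subrKA (u (n + m)%N)).
    have := ler_wpM2l (ltW d0) (le_hnormD ipP (u (n + m).+1 - u (n + m)%N) (u (n + m)%N - u n)).
    have := ler_wpM2l (ltW d0) (step (n + m)%N).
    by rewrite exprS; lra.
  apply: le_trans tail' _; rewrite ler_wpM2r // gerBl exprn_ge0 //.
have [l ul] : exists l, Defs.cvg_to ip u l.
  apply: ip_complete => e e0.
  have [n0 small] := expr_eventually_lt k ((1 - k) * e / (C + 1)) k0 k1
    (divr_gt0 (mulr_gt0 d0 e0) (ltr_wpDl C0 ltr01)).
  have close n m : (n0 <= n)%N -> (n <= m)%N -> hn (u m - u n) < e.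
    move=> len lenm; have := tail n (m - n)%N; rewrite subnKC // => tnm.
    rewrite -(ltr_pM2l d0); apply: le_lt_trans tnm _.
    have := small n len; rewrite ltr_pdivlMr ?ltr_wpDl //.
    by apply: le_lt_trans; rewrite ler_wpM2l ?exprn_ge0 // lerDl.
  exists n0 => m n lem len; have [nm|mn] := leqP n m; first exact: close.
  by rewrite hnorm_distC // close // ltnW.
exists l; apply/eqP; rewrite -subr_eq0; apply/eqP/(hnorm_eq0 ipP)/eqP.
rewrite eq_le hnorm_ge0 andbT; apply/ler_addgt0Pr => e e0; rewrite add0r.
have [n0 near_l] := ul (e / 2) ltac:(by rewrite divr_gt0).
rewrite -(subrKA (u n0.+1)).
apply: le_trans (le_hnormD ipP _ _) _.
have := gk l (u n0); rewrite -/(u n0.+1) [hn (l - _)]hnorm_distC // => gl.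
have := near_l n0 (leqnn _); have := near_l n0.+1 (leqnSn _).
have := ler_piMl (hnorm_ge0 (ip := ip) (u n0 - l)) (ltW k1).
by move: gl; change (g (u n0)) with (u n0.+1); lra.
Qed.

(* Richardson iteration: [x - t (B x - y)] is a strict contraction for small [t]. *)
Lemma lax_milgram (B : V -> V) (M delta : R) : 0 < delta ->
  (forall x y, B (x - y) = B x - B y) ->
  (forall x, hn (B x) <= M * hn x) ->
  (forall x, delta * hn x ^+ 2 <= complex.Re (ip (B x) x)) ->
  forall y, exists x, B x = y.
Proof.
move=> delta0 BB BM Bcoer y; pose K := `|M| + delta.
have K0 : 0 < K by rewrite ltr_wpDl.
have BK x : hn (B x) <= K * hn x.
  apply: le_trans (BM x) _; rewrite ler_wpM2r ?hnorm_ge0 //.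
  by apply: le_trans (ler_norm M) _; rewrite lerDl ltW.
have r1 : delta / K <= 1 by rewrite ler_pdivrMr // mul1r lerDr.
have r0 : 0 < delta / K by rewrite divr_gt0.
(* The value [t = delta / K^2] minimizes [1 - 2 t delta + t^2 K^2], with minimum
   [1 - (delta / K)^2 = k^2]. Including [delta] in [K] keeps this nonnegative. *)
pose t := delta / K / K; pose k := Num.sqrt (1 - (delta / K) ^+ 2).
have t0 : 0 < t by rewrite divr_gt0.
have rad0 : 0 <= 1 - (delta / K) ^+ 2 by rewrite subr_ge0 expr_le1 // ltW.
pose g x := x - t%:C%C *: (B x - y).
have [||x x' |x] := contraction_fixpoint g k.
- exact: sqrtr_ge0.
- by rewrite -sqrtr1 ltr_sqrt // gtrBl exprn_gt0.
- have -> : g x - g x' = (x - x') - t%:C%C *: B (x - x').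
    have -> : B (x - x') = (B x - y) - (B x' - y) by rewrite BB opprB addrA subrK.
    rewrite /g (scalerBr _ (B x - y)); move: (_ *: _) (_ *: _) => p q.
    by rewrite (opprD x') opprB opprK addrACA (addrC p).
  rewrite -ler_sqr ?nnegrE ?mulr_ge0 ?sqrtr_ge0 ?hnorm_ge0 //.
  rewrite exprMn [k ^+ 2]sqr_sqrtr // hnormD_sqr // hnormN // hnormZ // ipNr // ipZr //.
  rewrite ReN conjc_real ReM_real (ip_conj ipP) Re_conjc.
  rewrite /cabs /= expr0n addr0 sqrtr_sqr gtr0_norm //.
  set d := x - x'; have := ler_wpM2l (ltW t0) (Bcoer d).
  have Bd2 : hn (B d) ^+ 2 <= K ^+ 2 * hn d ^+ 2.
    by rewrite -exprMn ler_sqr ?nnegrE ?mulr_ge0 ?hnorm_ge0 // ltW.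
  have := ler_wpM2l (sqr_ge0 t) Bd2.
  have -> : t ^+ 2 * (K ^+ 2 * hn d ^+ 2) = (delta / K) ^+ 2 * hn d ^+ 2.
    by rewrite /t; field; rewrite gt_eqF.
  have -> : t * (delta * hn d ^+ 2) = (delta / K) ^+ 2 * hn d ^+ 2.
    by rewrite /t; field; rewrite gt_eqF.
  by rewrite (exprMn _ t); lra.
move=> /eqP; rewrite /g -subr_eq0 addrAC subrr add0r oppr_eq0 scaler_eq0 subr_eq0.
case/orP => [/eqP/complexI t_eq0|/eqP]; last by exists x.
by rewrite t_eq0 ltxx in t0.
Qed.

End LaxMilgram.

(** * Unitary operators on the direct sum *)

Section DirectSum.
Context {R : realType} {V : lmodType R[i]} {ip : V -> V -> R[i]} {N : nat}.
Hypothesis ipP : is_inner_product ip.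
Local Notation W := (V * 'cV[R[i]]_N)%type.

Lemma ipsumP : is_inner_product (ipsum ip N).
Proof.
split=> [a x y z|x y|x|x].
- rewrite /ipsum /= (ipDl ipP) (ipZl ipP) mulrDr addrACA mulr_sumr -big_split /=.
  by congr (_ + _); apply: eq_bigr => i _; rewrite !mxE mulrDl mulrA.
- rewrite /ipsum rmorphD /= -(ip_conj ipP) rmorph_sum; congr (_ + _).
  by apply: eq_bigr => i _; rewrite rmorphM /= conjcK mulrC.
- have -> : ipsum ip N x x =
      (hnorm ip x.1 ^+ 2 + \sum_(i < N) cabs (x.2 i 0) ^+ 2)%:C%C.
    rewrite /ipsum (ip_self ipP) rmorphD /= rmorph_sum; congr (_ + _).
    by apply: eq_bigr => i _; rewrite mul_conjc.
  by split=> //=; rewrite addr_ge0 ?sqr_ge0 // sumr_ge0 // => i _; rewrite sqr_ge0.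
case: x => x xi; rewrite /ipsum /= (ip_self ipP) => /(congr1 (@complex.Re _)).
have -> : \sum_(i < N) xi i 0 * conjc (xi i 0) = (\sum_(i < N) cabs (xi i 0) ^+ 2)%:C%C.
  by rewrite rmorph_sum; apply: eq_bigr => i _; rewrite mul_conjc.
move=> /= /eqP.
rewrite paddr_eq0 ?sqr_ge0 ?sumr_ge0 // => [/andP[]|i _]; last by rewrite sqr_ge0.
rewrite expf_eq0 /= => /eqP/(hnorm_eq0 ipP) ->.
rewrite psumr_eq0 => [|i _]; last by rewrite sqr_ge0.
move=> /allP xi0; congr pair; apply/colP => i; rewrite mxE.
have := xi0 i (mem_index_enum _); rewrite expf_eq0 /= => /eqP; exact: cabs_eq0.
Qed.

Lemma ipsum_inl (x : V) (p : W) : ipsum ip N (x, 0) p = ip x p.1.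
Proof. by rewrite /ipsum big1 ?addr0 // => i _; rewrite mxE mul0r. Qed.

Lemma hnorm_inl (x : V) : hnorm (ipsum ip N) (x, 0) = hnorm ip x.
Proof. by rewrite /hnorm ipsum_inl. Qed.

End DirectSum.

Section UnitaryIsometry.
Context {R : realType} {V : lmodType R[i]} {ip : V -> V -> R[i]}.
Hypothesis ipP : is_inner_product ip.

(** Any right inverse [Us] is the adjoint, as [<U x, y> = <U x, U (Us y)> = <x, Us y>], and
    injectivity of the isometry makes it two-sided. *)
Lemma unitary_of_surjective_isometry (U : V -> V) :
  linear U -> (forall x y, ip (U x) (U y) = ip x y) -> (forall y, exists x, U x = y) ->
  unitary ip U.
Proof.
move=> Ulin Uiso Usurj; have [Us UsK] := choice Usurj.
have hU x : hnorm ip (U x) = hnorm ip x by rewrite /hnorm Uiso.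
have Uinj : injective U.
  move=> x y Uxy; apply/eqP; rewrite -subr_eq0; apply/eqP/(hnorm_eq0 ipP).
  rewrite -hU -scaleN1r addrC Ulin scaleN1r Uxy addNr; exact: hnorm0.
split; first by split=> //; exists 1 => x; rewrite hU mul1r.
exists Us; split=> // [x y|x]; first by rewrite -{1}(UsK y) Uiso.
by apply: Uinj; rewrite UsK.
Qed.

Lemma unitary_ip (U : V -> V) x y : unitary ip U -> ip (U x) (U y) = ip x y.
Proof. by case=> _ [Us [Uadj UK _]]; rewrite Uadj UK. Qed.

Lemma unitary_hnorm (U : V -> V) x : unitary ip U -> hnorm ip (U x) = hnorm ip x.
Proof. by move=> Uu; rewrite /hnorm unitary_ip. Qed.

End UnitaryIsometry.

(** * Defect spaces and unitary dilations *)

Lemma linear_lincomb {K : pzRingType} {V W : lmodType K} (f : {linear V -> W}) N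
    (r : 'I_N -> K) (e : 'I_N -> V) :
  f (\sum_i r i *: e i) = \sum_i r i *: f (e i).
Proof. by rewrite linear_sum; apply: eq_bigr => i _; rewrite linearZ. Qed.

Section Defect.
Context {R : realType} {V : lmodType R[i]} {ip : V -> V -> R[i]}.
Hypothesis ipP : is_inner_product ip.

(* [c] is the family of columns of an injective [C^* : C^N -> V] with [C^* C = 1 - S T];
   [y] is a dual family, which witnesses the injectivity. *)
Definition defect_frame (T S : V -> V) N (c y : 'I_N -> V) : Prop :=
  (forall x, x - S (T x) = \sum_i ip x (c i) *: c i) /\
  (forall i j, ip (y i) (c j) = (i == j)%:R).

Lemma ip_dual_family N (e f : 'I_N -> V) (r : 'I_N -> R[i]) j :
  (forall i, ip (e i) (f j) = (i == j)%:R) -> ip (\sum_i r i *: e i) (f j) = r j.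
Proof.
move=> ef; rewrite (ip_suml ipP) (bigD1 j) //= big1 ?addr0 => [|i /negPf ij].
  by rewrite (ipZl ipP) ef eqxx mulr1.
by rewrite (ipZl ipP) ef ij mulr0.
Qed.

Lemma adjoint_sym (T S : V -> V) : is_adjoint ip T S -> is_adjoint ip S T.
Proof. by move=> TS x y; rewrite (ip_conj ipP) -TS -(ip_conj ipP). Qed.

Lemma adjoint_linear (T S : V -> V) : is_adjoint ip T S -> linear S.
Proof.
move=> TS a x y; apply: (ip_extl ipP) => z; rewrite (ipDl ipP) (ipZl ipP).
by rewrite !(adjoint_sym _ _ TS) (ipDl ipP) (ipZl ipP).
Qed.

Lemma adjoint_contraction (T S : V -> V) :
  is_adjoint ip T S -> contraction ip T -> contraction ip S.
Proof.
move=> TS Tc x; have [->|Sx0] := eqVneq (hnorm ip (S x)) 0; first exact: hnorm_ge0.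
have pos : 0 < hnorm ip (S x) by rewrite lt0r Sx0 hnorm_ge0.
rewrite -(ler_pM2l pos) -expr2 (hnorm_sqr ipP) -TS.
apply: le_trans (Re_ip_le ipP _ _) _.
by rewrite ler_wpM2r ?hnorm_ge0.
Qed.

(** Take [c i = D (e i)], with [e] an orthonormal basis of the closed range of the defect operator
    [D]; then [D^2 = 1 - S T] is the required expansion. Since [D] is self-adjoint, its kernel is
    orthogonal to that closed range, so the matrix [M] of [D] in the basis [e] is invertible, and
    the rows of its inverse give the dual family. *)
Lemma defect_frameP (T S : V -> V) N :
  defect_dim ip T S N -> exists c y : 'I_N -> V, defect_frame T S N c y.
Proof.
case=> D [[[[Dlin _] Dsa _] D2] [e [eON e_ran e_span]]].
have D_sym x z : ip (D x) z = ip x (D z) := Dsa x z.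
have Dlinear : linear D := Dlin.
pose DL : {linear V -> V} := HB.pack D (GRing.isLinear.Build _ _ _ _ D Dlinear).
have D_lincomb (r : 'I_N -> R[i]) (f : 'I_N -> V) :
    D (\sum_i r i *: f i) = \sum_i r i *: D (f i).
  exact: (linear_lincomb DL).
have ker_orth v w : D v = 0 -> in_closure_range ip D w -> ip v w = 0.
  move=> Dv0 w_ran; apply: cabs_eq0; apply/eqP.
  rewrite eq_le cabs_ge0 andbT; apply/ler_addgt0Pr => eps eps0; rewrite add0r.
  have d0 : 0 < hnorm ip v + 1 by rewrite ltr_wpDl ?hnorm_ge0.
  have [x xw] := w_ran _ (divr_gt0 eps0 d0).
  have -> : ip v w = ip v (w - D x) by rewrite (ipBr ipP) -D_sym Dv0 (ip0l ipP) subr0.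
  apply: le_trans (cabs_ip_le ipP _ _) _.
  apply: le_trans (ler_wpM2l (hnorm_ge0 v) (ltW xw)) _.
  by rewrite mulrCA ger_pMr // ler_pdivrMr // mul1r lerDl.
have D_expand x : D x = \sum_i ip x (D (e i)) *: e i.
  have Dx_ran : in_closure_range ip D (D x).
    by move=> eps eps0; exists x; rewrite subrr (hnorm0 ipP).
  by rewrite {1}(e_span _ Dx_ran); apply: eq_bigr => i _; rewrite D_sym.
pose M : 'M[R[i]]_N := \matrix_(i, j) ip (e i) (D (e j)).
have M_unit : M \in unitmx.
  rewrite -row_free_unit -kermx_eq0; apply/eqP/row_matrixP => k; rewrite row0.
  set r := row k _; have rM : r *m M = 0 by apply/sub_kermxP; rewrite row_sub.
  pose v := \sum_i r 0 i *: e i.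
  have Dv0 : D v = 0.
    rewrite D_expand big1 // => j _; rewrite (ip_suml ipP).
    transitivity ((r *m M) 0 j *: e j); last by rewrite rM mxE scale0r.
    by congr (_ *: _); rewrite mxE; apply: eq_bigr => i _; rewrite (ipZl ipP) [M i j]mxE.
  apply/rowP => j; rewrite [RHS]mxE -(ker_orth v (e j)) //.
  by rewrite (ip_dual_family _ e e).
exists (fun i => D (e i)), (fun i => \sum_k invmx M i k *: e k); split=> [x|i j].
  by rewrite -D2 (D_expand x) D_lincomb.
have /matrixP/(_ i j) := mulVmx M_unit; rewrite !mxE => <-.
by rewrite (ip_suml ipP); apply: eq_bigr => k _; rewrite !mxE (ipZl ipP).
Qed.

End Defect.

Section Dilations.
Context {R : realType} {V : lmodType R[i]} {ip : V -> V -> R[i]} {N : nat}.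
Hypothesis ipP : is_inner_product ip.
Context {T S : {linear V -> V}} {c y : 'I_N -> V}.
Hypothesis TS : is_adjoint ip T S.
Hypothesis frameT : defect_frame (ip := ip) T S N c y.
Local Notation W := (V * 'cV[R[i]]_N)%type.

Definition lincomb (e : 'I_N -> V) (xi : 'cV[R[i]]_N) : V := \sum_i xi i 0 *: e i.

(** This is [C], the adjoint of [lincomb c]; the entries are pairings with [c], not coefficients in
    a basis. *)
Definition coords (x : V) : 'cV[R[i]]_N := \col_i ip x (c i).

Lemma lincombP e (a : R[i]) (xi eta : 'cV[R[i]]_N) :
  lincomb e (a *: xi + eta) = a *: lincomb e xi + lincomb e eta.
Proof.
rewrite /lincomb scaler_sumr -big_split; apply: eq_bigr => i _.
by rewrite !mxE scalerDl scalerA.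
Qed.

Lemma lincomb0 e : lincomb e 0 = 0.
Proof. by rewrite /lincomb big1 // => i _; rewrite mxE scale0r. Qed.

Lemma lincombZ e (a : R[i]) (xi : 'cV[R[i]]_N) : lincomb e (a *: xi) = a *: lincomb e xi.
Proof. by have := lincombP e a xi 0; rewrite lincomb0 !addr0. Qed.

Lemma lincombB e (xi eta : 'cV[R[i]]_N) :
  lincomb e (xi - eta) = lincomb e xi - lincomb e eta.
Proof. by have := lincombP e (-1) eta xi; rewrite !scaleN1r ![- _ + _]addrC. Qed.

Lemma coordsP (a : R[i]) x z : coords (a *: x + z) = a *: coords x + coords z.
Proof. by apply/colP => i; rewrite !mxE (ipDl ipP) (ipZl ipP). Qed.

Lemma lincomb_inj xi : lincomb c xi = 0 -> xi = 0.
Proof.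
move=> xi0; apply/colP => j; rewrite mxE.
rewrite -(ip0l ipP (y j)) -xi0 (ip_dual_family ipP _ c y) // => i.
by rewrite (ip_conj ipP) frameT.2 conjc_nat eq_sym.
Qed.

(* The isometry that every unitary dilation (up to a unitary of C^N) restricts to on V. *)
Definition iso_ext (x : V) : W := (T x, coords x).
Definition iso_ext_adj (p : W) : V := S p.1 + lincomb c p.2.

Lemma iso_ext_adjP x p : ipsum ip N (iso_ext x) p = ip x (iso_ext_adj p).
Proof.
rewrite /ipsum /iso_ext_adj (ipDr ipP) TS (ip_sumr ipP); congr (_ + _).
by apply: eq_bigr => i _; rewrite mxE (ipZr ipP) mulrC.
Qed.

Lemma coordsK x : lincomb c (coords x) = x - S (T x).
Proof. by rewrite frameT.1; apply: eq_bigr => i _; rewrite mxE. Qed.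

Lemma iso_extK x : iso_ext_adj (iso_ext x) = x.
Proof. by rewrite /iso_ext_adj /= coordsK addrC subrK. Qed.

Lemma iso_extP (a : R[i]) x z : iso_ext (a *: x + z) = a *: iso_ext x + iso_ext z.
Proof. by rewrite /iso_ext linearP coordsP. Qed.

(* [p = (x, xi)] goes to [J (x - l p) + k p] with [J = iso_ext]; as [J^* (k p) = l p], the
   cross terms are [<x - l, l'> + <l, x' - l'>]. *)
Lemma dilation_of_extension (l : W -> V) (k : W -> W) :
  linear l -> linear k -> (forall p, iso_ext_adj (k p) = l p) ->
  (forall p q, ipsum ip N (k p) (k q) =
     ip (l p) (l q) + \sum_(i < N) p.2 i 0 * conjc (q.2 i 0)) ->
  (forall x, l (x, 0) = 0) -> (forall x, (k (x, 0)).1 = 0) ->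
  let U p := iso_ext (p.1 - l p) + k p in
  (forall q, exists p, U p = q) -> unitary_dilation ip N T U.
Proof.
move=> llin klin kl kk l0 k0 U Usurj; have sP := ipsumP (N := N) ipP.
have ksym x q : ipsum ip N (k q) (iso_ext x) = ip (l q) x.
  by rewrite (ip_conj sP) iso_ext_adjP kl -(ip_conj ipP).
split; last by move=> x; rewrite /U /= k0 l0 subr0 addr0.
apply: (unitary_of_surjective_isometry sP) => // [a p q|p q].
  rewrite /U klin llin.
  have -> : (a *: p + q).1 - (a *: l p + l q) = a *: (p.1 - l p) + (q.1 - l q).
    by rewrite scalerBr opprD addrACA.
  by rewrite iso_extP scalerDr addrACA.
rewrite /U (ipDl sP) !(ipDr sP) !iso_ext_adjP ksym kk kl iso_extK /ipsum.
rewrite !(ipBl ipP) !(ipBr ipP); ring.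
Qed.

(* The eigenspace is the graph [{(L xi, xi)}] with [L = (mu^* - S)^-1 C^*], a complement of [V];
   the isometry given by [iso_ext] on [V] and by [mu] on this graph is onto. *)
Lemma exists_dilation_with_eigenspace (mu : R[i]) : mu * conjc mu = 1 ->
  (forall v, exists x, mu *: x - T x = v) ->
  (forall v, exists x, conjc mu *: x - S x = v) ->
  (forall x, conjc mu *: x = S x -> x = 0) ->
  exists2 U, unitary_dilation ip N T U &
    forall p, exists x w, p = (x, 0) + w /\ U w = mu *: w.
Proof.
move=> mu1 muT muS muS_inj.
have [b bE] := choice (fun i => muS (c i)).
have LE xi : conjc mu *: lincomb b xi - S (lincomb b xi) = lincomb c xi.
  have -> : S (lincomb b xi) = \sum_j xi j 0 *: S (b j) by exact: linear_lincomb.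
  rewrite /lincomb scaler_sumr -sumrB; apply: eq_bigr => i _.
  by rewrite scalerA [_ * xi i 0]mulrC -scalerA -scalerBr bE.
have muK (v : V) : conjc mu *: (mu *: v) = v by rewrite scalerA mulrC mu1 scale1r.
pose l (p : W) := lincomb b p.2; pose k (p : W) : W := mu *: (lincomb b p.2, p.2).
have U0 w : w.1 - l w = 0 -> iso_ext (w.1 - l w) = 0.
  by move=> ->; rewrite /iso_ext linear0; congr pair; apply/colP => i; rewrite !mxE (ip0l ipP).
exists (fun p => iso_ext (p.1 - l p) + k p); last first.
  move=> p; exists (p.1 - l p), (l p, p.2); split.
    by rewrite {1}[p]surjective_pairing; congr pair; rewrite /= ?subrK ?add0r.
  by rewrite U0 ?add0r //= subrr.
apply: dilation_of_extension => //.
- by move=> a p q; rewrite /l /= lincombP.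
- move=> a p q; rewrite /k /= lincombP scalerA mulrC -scalerA -scalerDr.
  by congr (_ *: _).
- move=> p; rewrite /iso_ext_adj /= lincombZ linearZ /= -scalerDr -LE addrC subrK.
  by rewrite scalerA mu1 scale1r.
- move=> p q; have sP := ipsumP (N := N) ipP.
  by rewrite (ipZl sP) (ipZr sP) mulrA mu1 mul1r.
- by move=> x; rewrite /l lincomb0.
- by move=> x; rewrite /k /= lincomb0 scaler0.
move=> q; pose r := conjc mu *: q.1 - S q.1 - lincomb c q.2.
have [h hE] := muT (- (mu *: r)).
have {}hE : h - conjc mu *: T h = - r.
  by rewrite -{1}[h]muK -scalerBr hE scalerN muK.
pose xi := conjc mu *: (q.2 - coords h).
have xiE : mu *: xi = q.2 - coords h by rewrite scalerA mu1 scale1r.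
exists (h + lincomb b xi, xi); rewrite /l /k /= addrK.
apply: injective_projections => /=; last by rewrite xiE addrC subrK.
apply/eqP; rewrite -subr_eq0; apply/eqP/muS_inj/eqP; rewrite -subr_eq0.
set L := mu *: lincomb b xi.
have LE' : conjc mu *: L - S L = lincomb c q.2 - (h - S (T h)).
  by rewrite /L -lincombZ xiE LE lincombB coordsK.
apply/eqP/(ip_extl ipP) => t; rewrite (ip0l ipP).
move: (congr1 (ip^~ t) LE') (congr1 (ip^~ t) hE).
rewrite /r !linearD !linearN /= !(ipDl ipP, ipNl ipP, ipZl ipP).
by move=> /eqP; rewrite -subr_eq0 => /eqP E1 /eqP; rewrite -subr_eq0 => /eqP E2;
  rewrite -[RHS](subrr 0) -{1}E1 -E2; ring.
Qed.

Context {c' y' : 'I_N -> V}.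
Hypothesis frameS : defect_frame (ip := ip) S T N c' y'.

(** [T] carries the span of [c] into the span of [c']. If [k] is orthogonal to all [c' i], then
    [k = T S k], so [C^* C S k = S k - S T S k = 0]; hence [C S k = 0], that is, [k] is orthogonal
    to every [T (c j)]. *)
Lemma defect_frame_sub j : exists xi, T (c j) = lincomb c' xi.
Proof.
have orth k : (forall i, ip k (c' i) = 0) -> ip k (T (c j)) = 0.
  move=> kc'; have kE : k = T (S k).
    apply/eqP; rewrite -subr_eq0 frameS.1 big1 // => i _.
    by rewrite kc' scale0r.
  rewrite -(adjoint_sym ipP _ _ TS); have : lincomb c (coords (S k)) = 0.
    by rewrite coordsK -kE subrr.
  by move=> /lincomb_inj/colP/(_ j); rewrite !mxE.
exists (\col_i ip (T (c j)) (y' i)); apply: (ip_extl ipP) => h.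
(* The dual family removes an oblique component of [h], leaving [k] orthogonal to every [c' i]. *)
pose k := h - \sum_i ip h (c' i) *: y' i.
have /orth kT i : ip k (c' i) = 0.
  by rewrite (ipBl ipP) (ip_dual_family ipP _ y' c') ?subrr // => n; exact: frameS.2.
move: kT; rewrite /k (ipBl ipP) => /eqP; rewrite subr_eq0 => /eqP hT.
rewrite (ip_conj ipP) hT -(ip_conj ipP) (ip_sumr ipP) (ip_suml ipP).
by apply: eq_bigr => i _; rewrite (ipZr ipP) (ipZl ipP) mxE -(ip_conj ipP) mulrC.
Qed.

(** This is the Halmos dilation with both defect spaces identified with [C^N]. For [J = iso_ext],
    the vector [(0, xi)] goes to [(Y xi, 0) - J (S (Y xi))], the part of [(Y xi, 0)] orthogonal to
    the range of [J]. Duality of [y'] and [c'] gives [<(1 - T S) Y xi, Y xi> = |xi|^2], whence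
    isometry. *)
Lemma exists_unitary_dilation : exists U, unitary_dilation ip N T U.
Proof.
pose Y := lincomb y'.
have YE xi : Y xi - T (S (Y xi)) = lincomb c' xi.
  rewrite frameS.1; apply: eq_bigr => i _; congr (_ *: _).
  by rewrite (ip_dual_family ipP _ y' c') // => n; exact: frameS.2.
pose l (p : W) := S (Y p.2); pose k (p : W) : W := (Y p.2, 0).
have kl p : iso_ext_adj (k p) = l p by rewrite /iso_ext_adj /= lincomb0 addr0.
exists (fun p => iso_ext (p.1 - l p) + k p); apply: dilation_of_extension => //.
- by move=> a p q; rewrite /l /Y /= lincombP linearP.
- by move=> a p q; rewrite /k /Y /= lincombP; congr pair; rewrite /= scaler0 addr0.
- move=> p q; rewrite ipsum_inl /= /l.
  have -> : ip (S (Y p.2)) (S (Y q.2)) = ip (T (S (Y p.2))) (Y q.2) by rewrite TS.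
  apply/eqP; rewrite -subr_eq0 opprD addrA -(ipBl ipP) YE (ip_suml ipP) subr_eq0; apply/eqP.
  apply: eq_bigr => i _; rewrite (ipZl ipP); congr (_ * _).
  by rewrite (ip_conj ipP) (ip_dual_family ipP _ y' c') // => n; exact: frameS.2.
- by move=> x; rewrite /l /Y lincomb0 linear0.
- by move=> x; rewrite /k /Y /= lincomb0.
(* [J^*] of the image of [(x, xi)] is [x] whatever [xi] is. So [x = J^* q], and [xi] is chosen to
   match the first components; the second ones then agree because [C^*] is injective. *)
move=> q; pose x := iso_ext_adj q.
have [xi xiE] : exists xi, q.1 - T x = lincomb c' xi.
  have [f fE] := choice defect_frame_sub.
  pose b := \col_i ip q.1 (c' i) - \sum_j q.2 j 0 *: f j.
  exists b.
  rewrite /x /iso_ext_adj linearD opprD addrA frameS.1 /b lincombB; congr (_ - _).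
    by apply: eq_bigr => i _; rewrite mxE.
  have -> : T (lincomb c q.2) = \sum_j q.2 j 0 *: T (c j) by exact: linear_lincomb.
  rewrite /lincomb.
  under [RHS]eq_bigr => i _ do rewrite summxE scaler_suml.
  rewrite exchange_big; apply: eq_bigr => j _ /=; rewrite fE scaler_sumr.
  by apply: eq_bigr => i _; rewrite mxE scalerA.
exists (x, xi); set p := (x, xi); set U := _ + _.
have U1 : U.1 = q.1.
  by rewrite /U /= linearB /l /= -addrA [- _ + _]addrC YE -xiE addrC subrK.
have Uadj : iso_ext_adj U = x.
  rewrite /U /iso_ext_adj /= linearD addr0 coordsK.
  by rewrite addrAC [S (T _) + _]addrC subrK subrK.
have : lincomb c (U.2 - q.2) = 0.
  move: Uadj; rewrite /x /iso_ext_adj U1 => /addrI Uadj.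
  by rewrite lincombB Uadj subrr.
move=> /lincomb_inj /eqP; rewrite subr_eq0 => /eqP U2.
by rewrite [LHS]surjective_pairing U1 U2 -surjective_pairing.
Qed.
End Dilations.

Section UnitaryEigenvectors.
Context {R : realType} {V : lmodType R[i]} {ip : V -> V -> R[i]}.
Hypothesis ipP : is_inner_product ip.

(* The Hermitian form [c <u, v> - Re (w^* <U u, v>)] vanishes on eigenvectors, so its sign on
   the whole space is decided on a complement of the eigenspace. *)
Lemma unitary_eigen_perturb (U : V -> V) (mu w : R[i]) (c : R) u v :
  unitary ip U -> mu * conjc mu = 1 -> complex.Re (conjc w * mu) = c ->
  U v = mu *: v ->
  complex.Re (conjc w * ip (U u) u) <= c * hnorm ip u ^+ 2 ->
  complex.Re (conjc w * ip (U (u + v)) (u + v)) <= c * hnorm ip (u + v) ^+ 2.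
Proof.
move=> Uu mu1 wmu Uv Hu; have [[Ulin _] _] := Uu.
have -> : U (u + v) = U u + U v by rewrite -{1}[u]scale1r Ulin scale1r.
(* The vector [v] is also an eigenvector of the adjoint of [U], for [conj mu], so the two cross
   terms add up to [2 c Re <u, v>]. *)
have uv : ip (U u) v = mu * ip u v.
  by rewrite -(unitary_ip U u v Uu) Uv (ipZr ipP) mulrA mu1 mul1r.
rewrite (hnormD_sqr ipP) (ipDl ipP) !(ipDr ipP) uv Uv !(ipZl ipP) (ip_self ipP v).
rewrite (ip_conj ipP v u) !mulrDr !mulrA.
move: wmu Hu; rewrite !ReD.
by case: (conjc w * mu) => a b /= <-; case: (ip u v) => p q /=; lra.
Qed.

End UnitaryEigenvectors.

(** * Dilations with numerical range in a prescribed half-plane *)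

Section HalfPlaneDilation.
Context {R : realType} {V : lmodType R[i]} {ip : V -> V -> R[i]} {N : nat}.
Hypothesis ipP : is_inner_product ip.
Hypothesis ip_complete : complete_ip ip.
Context {T S : {linear V -> V}} {c y : 'I_N -> V}.
Hypothesis TS : is_adjoint ip T S.
Hypothesis Tc : contraction ip T.
Hypothesis frameT : defect_frame (ip := ip) T S N c y.

Lemma exists_dilation_Re_le (w : R[i]) (c1 c2 : R) : w != 0 -> c1 < c2 -> `|c2| <= cabs w ->
  (forall x, complex.Re (conjc w * ip (T x) x) <= c1 * hnorm ip x ^+ 2) ->
  exists2 U, unitary_dilation ip N T U &
    forall p, complex.Re (conjc w * ipsum ip N (U p) p) <= c2 * hnorm (ipsum ip N) p ^+ 2.
Proof.
move=> w0 c12 c2w Tc1.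
have [mu [mu_abs mu1 wmu]] := exists_unimodular_Re w c2 w0 c2w.
have Sc := adjoint_contraction ipP _ _ TS Tc.
(* Stated for a general operator so as to serve both [T], with [conj w] and [mu], and [S], with [w]
   and [conj mu]. *)
have coercive (A : {linear V -> V}) (a m : R[i]) : a != 0 -> cabs m = 1 ->
    complex.Re (a * m) = c2 -> contraction ip A ->
    (forall x, complex.Re (a * ip (A x) x) <= c1 * hnorm ip x ^+ 2) ->
    (forall v, exists x, m *: x - A x = v) /\ (forall x, m *: x = A x -> x = 0).
  move=> a0 m1 am Ac Ac1; pose B x := a *: (m *: x - A x).
  have Bcoer x : (c2 - c1) * hnorm ip x ^+ 2 <= complex.Re (ip (B x) x).
    rewrite /B (ipZl ipP) (ipBl ipP) (ipZl ipP) mulrBr ReB [a * (m * _)]mulrA (ip_self ipP).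
    have -> : complex.Re (a * m * (hnorm ip x ^+ 2)%:C%C) = c2 * hnorm ip x ^+ 2.
      by rewrite mulrC ReM_real am mulrC.
    by rewrite mulrBl lerB.
  split=> [v|x mA].
    have [|x z|x|x Bx] := lax_milgram ipP ip_complete B (cabs a * 2) (c2 - c1) _ _ _ Bcoer (a *: v).
    - by rewrite subr_gt0.
    - by rewrite /B -scalerBr (linearB A) (scalerBr m) !opprD !opprK addrACA.
    - rewrite /B (hnormZ ipP) -mulrA ler_wpM2l ?cabs_ge0 //.
      apply: le_trans (le_hnormB ipP _ _) _; rewrite (hnormZ ipP) m1 mul1r.
      by rewrite mulr_natl mulr2n lerD2l.
    by exists x; apply: (scalerI a0).
  have := Bcoer x; rewrite /B mA subrr scaler0 (ip0l ipP) /= => H.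
  apply: (hnorm_eq0 ipP); apply/eqP; rewrite -sqrf_eq0 eq_le sqr_ge0 andbT.
  by rewrite -(pmulr_rle0 _ (_ : 0 < c2 - c1)) // subr_gt0.
have [|muT _] := coercive T (conjc w) mu _ mu_abs wmu Tc Tc1.
  by rewrite conjc_eq0.
have [muS muS_inj] : (forall v, exists x, conjc mu *: x - S x = v) /\
    (forall x, conjc mu *: x = S x -> x = 0).
  apply: (coercive S w) => //; first by rewrite cabs_conjc.
    by rewrite -Re_conjc rmorphM /= conjcK.
  move=> x; rewrite -Re_conjc rmorphM /= -(ip_conj ipP) -TS; exact: Tc1.
have [U Udil Udec] := exists_dilation_with_eigenspace ipP TS frameT mu mu1 muT muS muS_inj.
exists U => // p; have [x [v [-> Uv]]] := Udec p.
have sP := ipsumP (N := N) ipP.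
apply: (unitary_eigen_perturb sP U mu) => //; first exact: Udil.1.
rewrite (ip_conj sP) ipsum_inl -(ip_conj ipP) Udil.2 hnorm_inl.
by apply: le_trans (Tc1 x) _; rewrite ler_wpM2r ?sqr_ge0 // ltW.
Qed.

End HalfPlaneDilation.

(** * Convex subsets of the plane *)

Section PlaneSets.
Context {R : realType}.
Implicit Types (A B : set R[i]) (w z a b : R[i]).

Lemma subset_clC A : A `<=` clC A.
Proof. by move=> z Az e e0; exists z => //; rewrite subrr /cabs Normc.normc0. Qed.

Lemma clC_Re_le A w (c : R) : (forall z, A z -> complex.Re (conjc w * z) <= c) ->
  forall z, clC A z -> complex.Re (conjc w * z) <= c.
Proof.
move=> Ac z Az; apply/ler_addgt0Pr => e e0.
have d0 : 0 < cabs w + 1 by rewrite ltr_wpDl ?cabs_ge0.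
have [a Aa za] := Az _ (divr_gt0 e0 d0).
rewrite -[z](subrK a) mulrDr ReD addrC lerD ?Ac //.
apply: le_trans (Re_le_cabs _) _; rewrite cabsM cabs_conjc.
apply: le_trans (ler_wpM2l (cabs_ge0 w) (ltW za)) _.
by rewrite mulrCA ger_pMr // ler_pdivrMr // mul1r lerDl.
Qed.

(* A maximizer in the closure is found coordinatewise: first the supremum [s1] of
   [Re (w^* z)], then the largest limit [s2] of [Im (w^* z)] along maximizing sequences. *)
Lemma clC_halfplane_gap A w (c M : R) : w != 0 -> A !=set0 -> (forall z, A z -> cabs z <= M) ->
  clC A `<=` halfplane w c ->
  exists2 c1, c1 < c & forall z, A z -> complex.Re (conjc w * z) <= c1.
Proof.
move=> w0 [a0 Aa0] AM Ac; have W0 := cabs_gt0 w w0.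
pose f z := complex.Re (conjc w * z); pose g z := complex.Im (conjc w * z).
have wM z : A z -> cabs (conjc w * z) <= cabs w * M.
  by move=> Az; rewrite cabsM cabs_conjc ler_wpM2l ?cabs_ge0 ?AM.
have fub : has_ubound (f @` A).
  exists (cabs w * M) => _ [z Az <-]; exact: le_trans (Re_le_cabs _) (wM z Az).
pose s1 := sup (f @` A).
have fs1 z : A z -> f z <= s1 by move=> Az; apply: ub_le_sup => //; exists z.
have fsup : has_sup (f @` A) by split=> //; exists (f a0), a0.
have [s1c|cs1] := ltP s1 c; first by exists s1.
pose L : set R := [set t | forall e, 0 < e -> exists z, [/\ A z, s1 - e < f z & t <= g z]].
have gM z : A z -> `|g z| <= cabs w * M.
  by move=> Az; apply: le_trans (normr_Im_le _) (wM z Az).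
have L0 : L !=set0.
  exists (- (cabs w * M)) => e e0.
  have [_ [z Az <-] zs1] := sup_adherent e0 fsup.
  by exists z; split=> //; have := gM z Az; rewrite ler_norml => /andP[].
have Lub : has_ubound L.
  exists (cabs w * M) => t /(_ 1 ltr01) [z [Az _ tz]].
  by apply: le_trans tz _; have := gM z Az; rewrite ler_norml => /andP[].
pose s2 := sup L.
pose z0 : R[i] := (s1 +i* s2)%C / conjc w.
have wz0 : conjc w * z0 = (s1 +i* s2)%C by rewrite /z0 mulrC divfK // conjc_eq0.
suff /Ac : clC A z0 by rewrite /halfplane /= wz0 /= ltNge cs1.
(* Both coordinates of [conj w * z] will be within [2 d] of those of [s1 + i s2], for a total below
   [4 d = |w| e]. *)
move=> e e0; pose d := cabs w * e / 4.
have d0 : 0 < d by rewrite divr_gt0 ?mulr_gt0.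
have [t Lt tz] := sup_adherent d0 (conj L0 Lub).
(* As [s2 + d] exceeds the supremum of [L], it fails the defining condition of [L] for some [e1]. *)
have [e1 e10 He1] : exists2 e1, 0 < e1 & forall z, A z -> s1 - e1 < f z -> g z < s2 + d.
  apply: contrapT => noe; have : L (s2 + d).
    move=> e1 e10; apply: contrapT => noz; apply: noe; exists e1 => // z Az zs1.
    rewrite ltNge; apply/negP => sz; apply: noz; by exists z.
  by move=> /(ub_le_sup Lub); rewrite -/s2 leNgt ltrDl d0.
have m0 : 0 < Num.min d e1 by rewrite lt_min d0.
have [z [Az zs1 tgz]] := Lt _ m0.
exists z => //; rewrite cabsC -(ltr_pM2l W0) -(cabs_conjc w) -cabsM mulrBr wz0.
apply: le_lt_trans (cabs_le_ReIm _) _; rewrite cabs_conjc.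
have dE : cabs w * e = 4 * d by rewrite /d; field.
have zd : s1 - d < f z by apply: le_lt_trans zs1; rewrite lerB // ge_min lexx.
have ze1 : s1 - e1 < f z by apply: le_lt_trans zs1; rewrite lerB // ge_min lexx orbT.
have := He1 z Az ze1; have := fs1 z Az; move: zd tgz tz; rewrite dE /f /g.
case: (conjc w * z) => p q /= h1 h2 h3 h4 h5.
have hp : `|p - s1| < 2 * d by rewrite ltr_norml; apply/andP; split; lra.
have hq : `|q - s2| < 2 * d by rewrite ltr_norml; apply/andP; split; rewrite -/s2 in h3; lra.
lra.
Qed.

(** An almost nearest point [a] of [A] takes the place of a nearest one. Comparing it with
    [a + t (b - a)] gives [Re (conj (z - a) (b - a)) <= D / 4] for all [b] in [A], whereas the same
    functional is at least [D] at [z - a]; the boundary line is put at [D / 2]. *)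
Lemma convex_separation A z (M : R) : A !=set0 -> (forall a, A a -> cabs a <= M) ->
  (forall a b (t : R), A a -> A b -> 0 < t -> t < 1 -> A (a + t%:C%C * (b - a))) ->
  ~ clC A z ->
  exists w c, [/\ w != 0, clC A `<=` halfplane w c & ~ halfplane w c z].
Proof.
move=> [a0 Aa0] AM Aconv Az.
have [e0 e00 He0] : exists2 e, 0 < e & forall a, A a -> e <= cabs (z - a).
  apply: contrapT => noe; apply: Az => e e0; apply: contrapT => noa; apply: noe.
  by exists e => // a Aa; rewrite leNgt; apply/negP => za; apply: noa; exists a.
pose Q := [set cabs (z - a) ^+ 2 | a in A]; pose D := inf Q.
have Qlb : has_lbound Q by exists 0 => _ [a _ <-]; exact: sqr_ge0.
have Qinf : has_inf Q by split=> //; exists (cabs (z - a0) ^+ 2), a0.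
have D0 : 0 < D.
  apply: lt_le_trans (_ : e0 ^+ 2 <= _); first by rewrite exprn_gt0.
  apply: lb_le_inf; first by case: Qinf.
  by move=> _ [a Aa <-]; rewrite ler_sqr ?nnegrE ?cabs_ge0 ?He0 // ltW.
have M0 : 0 <= M by apply: le_trans (cabs_ge0 a0) (AM _ Aa0).
(* [1] accounts for the error [t^2] in the choice of [a], and [4 M^2] bounds [|b - a|^2]; then [t]
   is taken small enough for [K t <= D / 2]. *)
pose K := 1 + 4 * M ^+ 2; have K0 : 0 < K by rewrite ltr_pwDl // mulr_ge0 ?sqr_ge0.
pose t := Num.min (1 / 2) (D / (2 * K)).
have t0 : 0 < t by rewrite lt_min !divr_gt0 ?mulr_gt0.
have t1 : t < 1 by rewrite gt_min; apply/orP; left; lra.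
have tD : K * t <= D / 2.
  have : t <= D / (2 * K) by rewrite ge_min lexx orbT.
  by rewrite ler_pdivlMr ?mulr_gt0 //; lra.
have [_ [a Aa <-] aD] := inf_adherent (exprn_gt0 2 t0) Qinf.
exists (z - a), (complex.Re (conjc (z - a) * a) + D / 2); split.
- by apply: contraTneq (He0 a Aa) => ->; rewrite /cabs Normc.normc0 -ltNge.
- move=> b /(clC_Re_le A (z - a) (complex.Re (conjc (z - a) * a) + D / 4)) Hb.
  rewrite /halfplane /=; apply: le_lt_trans (Hb _) _; last by lra.
  move=> {Hb} {b} b Ab; rewrite -lerBlDl -ReB -mulrBr.
  have ba : cabs (b - a) ^+ 2 <= 4 * M ^+ 2.
    have -> : 4 * M ^+ 2 = (M + M) ^+ 2 by ring.
    rewrite ler_sqr ?nnegrE ?cabs_ge0 ?addr_ge0 //.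
    by apply: le_trans (le_cabsD _ _) _; rewrite cabsN lerD ?AM.
  have := ge_inf Qlb (_ : Q (cabs (z - (a + t%:C%C * (b - a))) ^+ 2)).
  move=> /(_ ltac:(by exists (a + t%:C%C * (b - a)) => //; apply: Aconv)).
  have -> : cabs (z - (a + t%:C%C * (b - a))) ^+ 2 =
      cabs (z - a) ^+ 2 - t * complex.Re (conjc (z - a) * (b - a)) *+ 2 +
      t ^+ 2 * cabs (b - a) ^+ 2.
    rewrite opprD addrA; move: (z - a) (b - a) => [u1 u2] [v1 v2].
    by rewrite !cabs_sqr /=; ring.
  rewrite -/D => DQ.
  have := ler_wpM2l (sqr_ge0 t) ba => t2ba.
  rewrite -(ler_pM2l t0); move: tD t2ba DQ aD; rewrite /K -/D.
  set r := complex.Re _; set m := cabs _ ^+ 2; set n := cabs (b - a) ^+ 2 => tD.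
  have := ler_wpM2l (ltW t0) tD; nra.
rewrite /halfplane /= => H.
have : D <= cabs (z - a) ^+ 2 by apply: ge_inf => //; exists a.
have <- : complex.Re (conjc (z - a) * (z - a)) = cabs (z - a) ^+ 2.
  by rewrite mulrC mul_conjc.
by move: H; rewrite mulrBr ReB; lra.
Qed.

End PlaneSets.

(** * Numerical ranges *)

Section NumericalRange.
Context {R : realType} {V : lmodType R[i]} {ip : V -> V -> R[i]}.
Hypothesis ipP : is_inner_product ip.

(** The imaginary part equals that of [conj l * (p - conj q)], so [l = p - conj q] works, and
    [l = 1] if this vanishes. *)
Lemma exists_phase_real (p q : R[i]) :
  exists2 l : R[i], l != 0 & complex.Im (conjc l * p + l * q) = 0.
Proof.
case: p q => [p1 p2] [q1 q2].
have [e0|ne0] := eqVneq ((p1 - q1) +i* (p2 + q2))%C 0; last first.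
  by exists ((p1 - q1) +i* (p2 + q2))%C => //=; ring.
exists 1; first exact: oner_neq0.
by case: e0 => _ /= e0; rewrite /= !mul0r !mul1r oppr0 mul0r !addr0.
Qed.

Lemma quadratic_root (a b c : R) : 0 < a -> 0 <= c -> exists s, a * s ^+ 2 + b * s - c = 0.
Proof.
move=> a0 c0; have disc : 0 <= b ^+ 2 + 4 * a * c.
  by rewrite addr_ge0 ?sqr_ge0 // !mulr_ge0 // ltW.
exists ((Num.sqrt (b ^+ 2 + 4 * a * c) - b) / (2 * a)).
set r := Num.sqrt _; have r2 : r ^+ 2 = b ^+ 2 + 4 * a * c by rewrite sqr_sqrtr.
have -> : a * ((r - b) / (2 * a)) ^+ 2 + b * ((r - b) / (2 * a)) - c =
    (r ^+ 2 - (b ^+ 2 + 4 * a * c)) / (4 * a) by field; rewrite gt_eqF.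
by rewrite r2 subrr mul0r.
Qed.

Lemma numrange_scale (T : {linear V -> V}) (z : R[i]) v :
  v <> 0 -> ip (T v) v = z * ip v v -> numrange ip T z.
Proof.
move=> v0 Tv; exists (((hnorm ip v)^-1)%:C%C *: v).
  by rewrite /= (hnorm_normalize ipP).
have n0 : hnorm ip v != 0 by apply/eqP => /(hnorm_eq0 ipP).
rewrite linearZ /= (ipZl ipP) (ipZr ipP) conjc_real Tv (ip_self ipP).
transitivity (z * ((hnorm ip v)^-1 * (hnorm ip v)^-1 * hnorm ip v ^+ 2)%:C%C).
  by rewrite !rmorphM /=; ring.
rewrite (_ : _ * _ * _ = 1) ?mulr1 //; by field.
Qed.

(** The form [B] is [T] renormalized to send [x] to [0] and [y] to [1]. For [v = x + s l y], the
    phase [l] makes [B v v] real for every real [s], so that [B v v = t <v, v>] becomes a real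
    quadratic equation in [s], with positive leading and negative constant coefficient. *)
Lemma toeplitz_hausdorff (T : {linear V -> V}) (a b : R[i]) (t : R) :
  numrange ip T a -> numrange ip T b -> 0 < t -> t < 1 ->
  numrange ip T (a + t%:C%C * (b - a)).
Proof.
move=> Wa Wb t0 t1; have [<-|ab] := eqVneq a b; first by rewrite subrr mulr0 addr0.
case: Wa => x /= x1 xa; case: Wb => y /= y1 yb.
have ba0 : b - a != 0 by rewrite subr_eq0 eq_sym.
pose B u v := (ip (T u) v - a * ip u v) / (b - a).
have Bxx : B x x = 0 by rewrite /B xa (ip_self ipP) x1 expr1n mulr1 subrr mul0r.
have Byy : B y y = 1 by rewrite /B yb (ip_self ipP) y1 expr1n mulr1 divff.
have [l l0 lreal] := exists_phase_real (B x y) (B y x).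
pose g := complex.Re (conjc l * B x y + l * B y x).
have gE : conjc l * B x y + l * B y x = g%:C%C.
  by move: lreal; rewrite /g; case: (_ + _) => g1 g2 /= ->.
pose rho := complex.Re (conjc l * ip x y); pose L := cabs l ^+ 2.
have L0 : 0 < L by rewrite exprn_gt0 // cabs_gt0.
have [|s sE] := quadratic_root ((1 - t) * L) (g - 2 * t * rho) t _ (ltW t0).
  by rewrite mulr_gt0 // subr_gt0.
pose c := s%:C%C * l; pose v := x + c *: y.
have cc : c * conjc c = (s ^+ 2 * L)%:C%C.
  by rewrite mul_conjc cabsM exprMn /cabs /= expr0n addr0 sqrtr_sqr real_normK ?num_real.
have cJ : conjc c = s%:C%C * conjc l by rewrite -[in RHS](conjc_real s) -rmorphM.
have Bvv : B v v = (s * g + s ^+ 2 * L)%:C%C.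
  transitivity (B x x + (conjc c * B x y + c * B y x) + (c * conjc c) * B y y).
    rewrite /B /v linearD linearZ /= !(ipDl ipP) !(ipDr ipP) !(ipZl ipP) !(ipZr ipP).
    by field.
  have -> : (s * g + s ^+ 2 * L)%:C%C = s%:C%C * g%:C%C + (s ^+ 2 * L)%:C%C :> R[i].
    by rewrite rmorphD rmorphM.
  by rewrite Bxx Byy cc cJ mulr1 add0r -gE /c; ring.
have vv : ip v v = (1 + 2 * s * rho + s ^+ 2 * L)%:C%C.
  rewrite (ip_self ipP) (hnormD_sqr ipP) (hnormZ ipP) x1 y1 mulr1 expr1n (ipZr ipP).
  congr (_%:C)%C; congr (1 + _ + _).
    by rewrite cJ -mulrA ReM_real /rho; ring.
  by rewrite cabsM exprMn /cabs /= expr0n addr0 sqrtr_sqr real_normK ?num_real.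
have BvE : B v v = t%:C%C * ip v v.
  rewrite Bvv vv -rmorphM; congr (_%:C)%C.
  by apply/eqP; rewrite -subr_eq0 -sE; apply/eqP; ring.
apply: (numrange_scale T _ v); last first.
  have -> : ip (T v) v = (b - a) * B v v + a * ip v v by rewrite /B; field.
  by rewrite BvE; ring.
(* If [v = 0], then [0 = B x x = |c|^2 B y y = |c|^2], hence [c = 0] and [x = 0], contradicting
   [|x| = 1]. *)
move=> v0; have xE : x = (- c) *: y.
  by apply/eqP; rewrite scaleNr -subr_eq0 opprK -/v v0.
have Bcc : B x x = c * conjc c * B y y.
  by rewrite /B xE linearZ /= !(ipZl ipP) !(ipZr ipP) rmorphN /=; field.
move: Bcc; rewrite Bxx Byy mulr1 cc => /esym/complexI/eqP.
rewrite mulf_eq0 (gt_eqF L0) orbF expf_eq0 /= => /eqP s0.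
move: x1; rewrite xE /c s0 mul0r oppr0 scale0r (hnorm0 ipP) => /eqP.
by rewrite eq_sym oner_eq0.
Qed.

Lemma numrange_bounded (T : V -> V) z :
  contraction ip T -> numrange ip T z -> cabs z <= 1.
Proof.
move=> Tc [x /= x1 <-]; apply: le_trans (cabs_ip_le ipP _ _) _.
by rewrite x1 mulr1 -x1.
Qed.

Lemma numrange_Re_homogeneous (T : {linear V -> V}) (w : R[i]) (c : R) :
  (forall z, numrange ip T z -> complex.Re (conjc w * z) <= c) ->
  forall x, complex.Re (conjc w * ip (T x) x) <= c * hnorm ip x ^+ 2.
Proof.
move=> Wc x; have [->|/eqP x0] := eqVneq x 0.
  by rewrite linear0 (ip0l ipP) mulr0 (hnorm0 ipP) expr0n mulr0.
have nn : ip x x != 0 by apply: contra_notN x0 => /eqP /(ip_eq0 ipP).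
have := Wc (ip (T x) x / ip x x) (numrange_scale T _ x x0 (esym (divfK nn _))).
have n0 : 0 < hnorm ip x ^+ 2.
  rewrite exprn_gt0 // lt0r hnorm_ge0 andbT.
  by apply: contra_notN x0 => /eqP /(hnorm_eq0 ipP).
rewrite -(ler_pM2r n0); congr (_ <= _).
by rewrite [LHS]mulrC -ReM_real -(ip_self ipP); congr complex.Re; field.
Qed.

(** Both values are taken at the same unit vector. Unitarity bounds the difference by 2, so the
    supremum in [opnorm] is a genuine one. *)
Lemma numrange_dist (U1 U2 : V -> V) (d : R) z1 :
  unitary ip U1 -> unitary ip U2 -> opnorm ip (fun p => U1 p - U2 p) <= d ->
  numrange ip U1 z1 -> exists2 z2, numrange ip U2 z2 & cabs (z1 - z2) <= d.
Proof.
move=> Uu1 Uu2 d12 [x /= x1 <-]; exists (ip (U2 x) x); first by exists x.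
rewrite -(ipBl ipP); apply: le_trans (cabs_ip_le ipP _ _) _; rewrite x1 mulr1.
apply: le_trans d12; apply: ub_le_sup; last by exists x => //=; rewrite x1.
exists 2 => _ [v /= v1 <-]; apply: le_trans (le_hnormB ipP _ _) _.
by rewrite !unitary_hnorm //; lra.
Qed.

End NumericalRange.

(** * Hausdorff distance between closures *)

Section Hausdorff.
Context {R : realType}.
Implicit Types (A B : set R[i]).

Lemma hausdorff_clC_le A B (d : R) : 0 < d ->
  (forall a, A a -> exists2 b, B b & cabs (a - b) <= d) ->
  (forall b, B b -> exists2 a, A a & cabs (a - b) <= d) ->
  hausdorff (clC A) (clC B) <= d.
Proof.
move=> d0.
have half (A' B' : set R[i]) : (forall a, A' a -> exists2 b, B' b & cabs (a - b) <= d) ->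
    sup [set inf [set cabs (a - b) | b in clC B'] | a in clC A'] <= d.
  (* The supremum of the empty set is 0 by convention, which [0 < d] covers. *)
  move=> AB; have [->|ne] := eqVneq [set inf [set cabs (a - b) | b in clC B'] | a in clC A'] set0.
    by rewrite sup0 ltW.
  apply: ge_sup; first exact/set0P.
  move=> _ [a cAa <-]; apply/ler_addgt0Pr => e e0.
  have [a' Aa' aa'] := cAa e e0; have [b Bb a'b] := AB a' Aa'.
  apply: le_trans (_ : cabs (a - b) <= _).
    apply: ge_inf; last by exists b => //; exact: subset_clC.
    by exists 0 => _ [? _ <-]; exact: cabs_ge0.
  rewrite -(subrKA a') addrC [d + e]addrC addrC.
  by apply: le_trans (le_cabsD _ _) _; rewrite lerD // ltW.
move=> AB BA; rewrite /hausdorff ge_max half //=.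
under eq_imagel => b _ do under eq_imagel => a _ do rewrite cabsC.
by apply: half => b /BA [a Aa ab]; exists a => //; rewrite cabsC.
Qed.

End Hausdorff.

Theorem theorem4p8 (R : realType) (V : lmodType R[i]) (ip : V -> V -> R[i])
  (N : nat) (T Tadj : V -> V) :
  is_hilbert ip -> bounded_op ip T -> is_adjoint ip T Tadj -> class_C0N ip T Tadj N ->
  wraps (unitary_dilation ip N T)
        (fun U1 U2 => opnorm (ipsum ip N) (fun p => U1 p - U2 p))
        (fun U => clC (numrange (ipsum ip N) U))
        (clC (numrange ip T))
  /\ (forall z, clC (numrange ip T) z <->
        (forall U, unitary_dilation ip N T U -> clC (numrange (ipsum ip N) U) z)).
Proof.
move=> [ipP ip_complete _] [Tlin _] TS [Tc defT defS _ _].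
have sP := ipsumP (N := N) ipP.
have Tlinear : linear T := Tlin.
have Slinear := adjoint_linear ipP _ _ TS.
pose TL : {linear V -> V} := HB.pack T (GRing.isLinear.Build _ _ _ _ T Tlinear).
pose SL : {linear V -> V} := HB.pack Tadj (GRing.isLinear.Build _ _ _ _ Tadj Slinear).
have [c [y frameT]] := defect_frameP ipP _ _ _ defT.
have [c' [y' frameS]] := defect_frameP ipP _ _ _ defS.
have Wbound z := @numrange_bounded R V ip ipP T z Tc.
have [U0 U0dil] := exists_unitary_dilation ipP (T := TL) (S := SL) TS frameT frameS.
have wrapsT (w : R[i]) (k : R) : w != 0 -> clC (numrange ip T) `<=` halfplane w k ->
    exists2 U, unitary_dilation ip N T U & clC (numrange (ipsum ip N) U) `<=` halfplane w k.
  move=> w0 Wk.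
  (* Without unit vectors [V] is zero; then [<y i, c i> = 1] forces [N = 0], so the direct sum is
     zero too and any dilation has empty numerical range. *)
  have [W0|Wne] := eqVneq (numrange ip T) set0.
    have V0 (x : V) : x = 0.
      apply: contrapT => x0.
      have : numrange ip T (ip (T (((hnorm ip x)^-1)%:C%C *: x)) (((hnorm ip x)^-1)%:C%C *: x)).
        by exists (((hnorm ip x)^-1)%:C%C *: x) => //=; exact: (hnorm_normalize ipP).
      by rewrite W0.
    have N0 (i : 'I_N) : False.
      have := frameT.2 i i; rewrite [y i]V0 (ip0l ipP) eqxx => /esym/eqP.
      by rewrite oner_eq0.
    exists U0 => // z /(_ 1 ltr01) [_ [p /= p1 _] _].
    have p0 : p = 0 by apply: injective_projections; [exact: V0 | apply/colP => i; case: (N0 i)].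
    by move: p1; rewrite p0 (hnorm0 sP) => /eqP; rewrite eq_sym oner_eq0.
  have [k1 k1k Wk1] := clC_halfplane_gap _ _ _ 1 w0 (proj1 (set0P _) Wne) Wbound Wk.
  have numrange_le U (k2 : R) : k2 < k ->
      (forall p, complex.Re (conjc w * ipsum ip N (U p) p) <= k2 * hnorm (ipsum ip N) p ^+ 2) ->
      clC (numrange (ipsum ip N) U) `<=` halfplane w k.
    move=> k2k Uk2 z /(clC_Re_le _ w k2) Hz; rewrite /halfplane /=.
    apply: le_lt_trans k2k; apply: Hz => _ [p /= p1 <-].
    by have := Uk2 p; rewrite p1 expr1n mulr1.
  have [wk|kw] := ltP (cabs w) k.
    exists U0 => //; apply: (numrange_le _ _ wk) => p.
    apply: le_trans (Re_le_cabs _) _; rewrite cabsM cabs_conjc ler_wpM2l ?cabs_ge0 //.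
    by apply: le_trans (cabs_ip_le sP _ _) _; rewrite (unitary_hnorm U0 p U0dil.1).
  (* With [k <= |w|], this places the midpoint [k2] in [[- |w|, |w|]]; it holds because [W(T)] is a
     nonempty part of the unit disc. *)
  have wk1 : - cabs w <= k1.
    have /set0P [z Wz] := Wne; apply: le_trans (Wk1 _ Wz).
    have := normr_Re_le (conjc w * z); rewrite cabsM cabs_conjc ler_norml => /andP[H _].
    by apply: le_trans H; rewrite lerN2 ler_piMr ?cabs_ge0 ?Wbound.
  (* [k1 < k2] is the coercivity gap, and [k2 < k] keeps the closure of the numerical range in the
     open half-plane. *)
  pose k2 := (k1 + k) / 2.
  have [||U Udil Uk2] := exists_dilation_Re_le ipP ip_complete (T := TL) (S := SL) TS Tc frameT
    w k1 k2 w0 _ _ (numrange_Re_homogeneous ipP TL w k1 Wk1).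
  - by rewrite /k2; lra.
  - by rewrite ler_norml; apply/andP; split; rewrite /k2; lra.
  by exists U => //; apply: numrange_le Uk2; rewrite /k2; lra.
split.
  split=> // U1 [U1u _] e e0; exists (e / 2); first by rewrite divr_gt0.
  move=> U2 [U2u _] /ltW d12.
  apply: (@le_lt_trans _ _ (e / 2)); last by lra.
  apply: hausdorff_clC_le; first by rewrite divr_gt0.
    by move=> z; apply: (numrange_dist sP).
  move=> z Uz; have [|z' Uz' zz'] := numrange_dist sP U2 U1 (e / 2) z U2u U1u _ Uz.
    apply: le_trans d12; rewrite le_eqVlt; apply/orP; left; apply/eqP.
    congr sup; apply/seteqP; split=> _ [p p1 <-]; exists p => //.
      by rewrite (hnorm_distC sP).
    by rewrite (hnorm_distC sP).
  by exists z' => //; rewrite cabsC.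
move=> z; split=> [Wz U [_ UT] e e0|Uz].
  have [_ [x /= x1 <-] zx] := Wz e e0; exists (ip (T x) x) => //.
  exists (x, 0); first by rewrite /= hnorm_inl.
  by rewrite (ip_conj sP) ipsum_inl UT -(ip_conj ipP).
apply: contrapT => Wz.
(* A half-plane containing the closure of [W(T)] but not [z] contains, by wrapping, the closed
   numerical range of some dilation, which then misses [z]. *)
suff [w [k [w0 Wk zk]]] :
    exists w k, [/\ w != 0, clC (numrange ip T) `<=` halfplane w k & ~ halfplane w k z].
  by have [U Udil Uk] := wrapsT w k w0 Wk; apply: zk; apply: Uk; apply: Uz.
(* If [W(T)] is empty, an open half-plane with [z] on its boundary separates. *)
have [W0|/set0P Wne] := eqVneq (numrange ip T) set0.
  exists 1, (complex.Re z); split; first exact: oner_neq0.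
    by rewrite W0 => v /(_ 1 ltr01) [].
  by rewrite /halfplane mksetE conjc1 mul1r ltxx.
apply: (convex_separation _ _ 1) => // a b t Wa Wb t0 t1.
exact: (toeplitz_hausdorff ipP TL).
Qed.
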